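(* Let $H(1)\equiv H(t,1,s)=\sum_{n\ge0}t^n\sum_{(P,Q)\in\mathcal{I}_n}\sum_{i=0}^{2n}s^{Q(i)}$. Let $z=z(t)$ be the formal power series defined by $t=z(1-z)^3$, $z=t+O(t^2)$. Let $P(u,z,s)=s(1+u)^2z(uz^2+2z-1)+u(1-z)^3$ and let $U=U(z,s)\in\mathbb{Q}[s][[z]]$ be the unique formal power series with $P(U,z,s)=0$ (so $U=sz+O(z^2)$). Then $$H(1)=\frac{(1-2z-Uz^2)^2(1+U)}{(1-z)^6},$$ and equivalently the pair $(t,s)$ is parametrized rationally by $(z,U)$ via $t=z(1-z)^3$ and $s=\dfrac{U(1-z)^3}{z(1+U)^2(1-Uz^2-2z)}$.
   Context: A Dyck path of size $n$ is a lattice path from $(0,0)$ to $(2n,0)$ with $n$ up-steps $(1,1)$ and $n$ down-steps $(1,-1)$ never going below height $0$; $Q(i)$ denotes the height of $Q$ at abscissa $i$. The Tamari order on Dyck paths of size $n$ is the reflexive transitive closure of the relation: if $P$ has a down-step $d$ immediately followed by an up-step and $\mathfrak{e}$ is the shortest excursion following $d$ (a subpath staying strictly above its starting height except at its last point), the path obtained by exchanging $d$ and $\mathfrak{e}$ is larger than $P$. $\mathcal{I}_n$ is the set of pairs $(P,Q)$ of Dyck paths of size $n$ with $P\le Q$. *)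

(* Defs.v *)
From HB Require Import structures.
From mathcomp Require Import all_boot all_order all_algebra.
Set Implicit Arguments. Unset Strict Implicit. Unset Printing Implicit Defensive.
Import Order.TTheory GRing.Theory Num.Theory.
Local Open Scope ring_scope.

(* Dyck paths, encoded as boolean words: true = up-step (1,1),          *)
(* false = down-step (1,-1).                                            *)

(* number of up-steps minus (truncated) number of down-steps among the
   first i steps; for a Dyck path this is the height Q(i) at abscissa i *)
Definition height (p : seq bool) (i : nat) : nat :=
  (count id (take i p) - count negb (take i p))%N.

Definition balanced (s : seq bool) : bool := count id s == count negb s.

Definition is_dyck (p : seq bool) : bool :=
  balanced p &&
  all (fun i => count negb (take i p) <= count id (take i p))%N
      (iota 0 (size p).+1).

Definition is_excursion (e : seq bool) : bool :=
  [&& (0 < size e)%N, balanced e &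
   all (fun i => count negb (take i e) < count id (take i e))%N
       (iota 1 (size e).-1)].

(* one elementary Tamari move: p has a down-step d at position j followed
   by an up-step; e = take k (drop j.+1 p) is the shortest excursion
   following d; q is obtained by exchanging d and e. *)
Definition tamari_step (p q : seq bool) : bool :=
  [exists j : 'I_(size p), [exists k : 'I_(size p).+1,
     [&& nth false p j == false,
         nth false p j.+1 == true,
         (j.+1 + k <= size p)%N,
         is_excursion (take k (drop j.+1 p)),
         [forall k' : 'I_k, ~~ is_excursion (take k' (drop j.+1 p))] &
         q == take j p ++ take k (drop j.+1 p) ++ false :: drop (j.+1 + k) p]]].

Definition word (n : nat) := (n.*2).-tuple bool.

Definition tamari_le (n : nat) (P Q : word n) : bool :=
  connect (fun P' Q' : word n => tamari_step P' Q') P Q.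

Definition fps (R : Type) := nat -> R.

Section FPS.
Variable R : pzRingType.
Definition fps_const (c : R) : fps R := fun n => if n is 0 then c else 0.
Definition fps_one : fps R := fps_const 1.
Definition fps_X : fps R := fun n => (n == 1)%:R.
Definition fps_add (f g : fps R) : fps R := fun n => f n + g n.
Definition fps_opp (f : fps R) : fps R := fun n => - f n.
Definition fps_sub (f g : fps R) : fps R := fps_add f (fps_opp g).
Definition fps_scale (k : nat) (f : fps R) : fps R := fun n => f n *+ k.
Definition fps_mul (f g : fps R) : fps R :=
  fun n => \sum_(i < n.+1) f i * g (n - i)%N.
Definition fps_pow (f : fps R) (k : nat) : fps R := iter k (fps_mul f) fps_one.
(* composition F(G) for G with zero constant term *)
Definition fps_comp (F G : fps R) : fps R :=
  fun n => \sum_(k < n.+1) F k * fps_pow G k n.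
End FPS.

Definition fps_map (R S : Type) (phi : R -> S) (f : fps R) : fps S :=
  fun n => phi (f n).

Definition H1 : fps {poly rat} := fun n =>
  \sum_(P : word n | is_dyck P)
    \sum_(Q : word n | is_dyck Q && tamari_le P Q)
      \sum_(i < (n.*2).+1) 'X^(height Q i).

Definition Pol_series (U : fps {poly rat}) : fps {poly rat} :=
  let X := fps_X {poly rat} in
  let one := fps_one {poly rat} in
  let S := fps_const 'X in
  fps_add
    (fps_mul S (fps_mul (fps_pow (fps_add one U) 2)
       (fps_mul X (fps_sub (fps_add (fps_mul U (fps_pow X 2)) (fps_scale 2 X)) one))))
    (fps_mul U (fps_pow (fps_sub one X) 3)).

(* Main.v *)
From HB Require Import structures.
Require Import Defs.
From mathcomp Require Import all_boot all_order all_algebra.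
From mathcomp Require Import boolp.
From mathcomp Require Import ring zify.
Set Implicit Arguments. Unset Strict Implicit. Unset Printing Implicit Defensive.
Import GRing.Theory.
Local Open Scope ring_scope.

(* Write [u] and [d] for the steps.  A Dyck path [P] satisfies [P <= u Q1 d Q2]
   iff [P = u A d B P2] with [A B <= Q1] and [P2 <= Q2].  Hence, with [x]
   counting the contacts of [P], the series [F(x)] of intervals and [H(x)] of
   intervals weighted by the heights of [Q] satisfy
     (x-1) (F(x)-1) = t x F(x) (x F(x) - F(1)),
     (x-1) (H(x) - F(x)^2) = t s x F(x)^2 (x H(x) - H(1)).
   The second equation is linear in [H(x)] with kernel [x - 1 - t s x^2 F(x)^2]:
   at the root [x = X] of the kernel it gives [H(1) = X F(X)^2].
   The contacts only occur as exponents of [x], so [F(X)] makes sense for [X] in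
   any ring of power series in [t].  With [v = s],
     X = (1+v) / (1+zv)^2,  F(X) = (1+zv) (1-2z-vz^2) / (1-z)^3
   solves the first equation, which identifies [F(1)] as the value at [s = 0];
   with [v = U] the same formulas describe the root of the kernel. *)

(** * The ring of formal power series *)

Section SeriesRing.
Variable R : comNzRingType.
Implicit Types f g h : fps R.

HB.instance Definition _ := gen_eqMixin (fps R).
HB.instance Definition _ := gen_choiceMixin (fps R).

Lemma fps_ext f g : f =1 g -> f = g.
Proof. by move=> fg; apply/funext. Qed.

Definition fps_zero : fps R := fun=> 0.

Lemma fps_addA : associative (@fps_add R).
Proof. by move=> f g h; apply: fps_ext => n; apply: addrA. Qed.
Lemma fps_addC : commutative (@fps_add R).
Proof. by move=> f g; apply: fps_ext => n; apply: addrC. Qed.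
Lemma fps_add0 : left_id fps_zero (@fps_add R).
Proof. by move=> f; apply: fps_ext => n; apply: add0r. Qed.
Lemma fps_addN : left_inverse fps_zero (@fps_opp R) (@fps_add R).
Proof. by move=> f; apply: fps_ext => n; apply: addNr. Qed.

HB.instance Definition _ :=
  GRing.isZmodule.Build (fps R) fps_addA fps_addC fps_add0 fps_addN.

(** Up to degree [n] the Cauchy product only sees polynomial truncations, so commutativity and
    associativity are inherited from [{poly R}]. *)
Lemma fps_mulE_poly f g N n : (n < N)%N ->
  fps_mul f g n = ((\poly_(i < N) f i) * (\poly_(i < N) g i))`_n.
Proof.
move=> nN; rewrite coefM; apply: eq_bigr => i _; rewrite !coef_poly.
by rewrite (leq_ltn_trans _ nN) ?(leq_ltn_trans _ nN) ?leq_subr // -ltnS.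
Qed.

Lemma fps_mulC : commutative (@fps_mul R).
Proof.
move=> f g; apply: fps_ext => n.
by rewrite !(@fps_mulE_poly _ _ n.+1) // mulrC.
Qed.

Lemma fps_mulA : associative (@fps_mul R).
Proof.
move=> f g h; apply: fps_ext => n.
pose T (k : fps R) := \poly_(i < n.+1) k i.
have E (k l : fps R) i : (i <= n)%N -> (T (fps_mul k l))`_i = (T k * T l)`_i.
  by move=> le_in; rewrite coef_poly ltnS le_in (@fps_mulE_poly _ _ n.+1).
rewrite !(@fps_mulE_poly _ _ n.+1) // -!/(T _).
transitivity ((T f * (T g * T h))`_n).
  by rewrite !coefM; apply: eq_bigr => i _; rewrite E ?leq_subr.
rewrite mulrA [in LHS]coefM [in RHS]coefM; apply: eq_bigr => i _.
by rewrite E // -ltnS.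
Qed.

Lemma fps_mul1 : left_id (@fps_one R) (@fps_mul R).
Proof.
move=> f; apply: fps_ext => n; rewrite /fps_mul big_ord_recl /= mul1r subn0.
by rewrite big1 ?addr0 // => i _; rewrite mul0r.
Qed.

Lemma fps_mulDl : left_distributive (@fps_mul R) (@fps_add R).
Proof.
move=> f g h; apply: fps_ext => n; rewrite /fps_mul /fps_add -big_split /=.
by apply: eq_bigr => i _; rewrite mulrDl.
Qed.

Lemma fps_one_neq0 : fps_one R != 0 :> fps R.
Proof.
by apply/eqP => /(congr1 (fun f : fps R => f 0%N)) /eqP; apply/negP/oner_neq0.
Qed.

HB.instance Definition _ :=
  GRing.Zmodule_isComNzRing.Build (fps R)
    fps_mulA fps_mulC fps_mul1 fps_mulDl fps_one_neq0.

Lemma fps_coefD f g n : (f + g) n = f n + g n. Proof. by []. Qed.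
Lemma fps_coefN f n : (- f) n = - f n. Proof. by []. Qed.
Lemma fps_coefB f g n : (f - g) n = f n - g n. Proof. by []. Qed.
Lemma fps_coef0 n : (0 : fps R) n = 0. Proof. by []. Qed.
Lemma fps_coef1 n : (1 : fps R) n = (n == 0)%:R. Proof. by case: n. Qed.
Lemma fps_coefM f g n : (f * g) n = \sum_(i < n.+1) f i * g (n - i)%N.
Proof. by []. Qed.
Lemma fps_coefM0 f g : (f * g) 0%N = f 0%N * g 0%N.
Proof. by rewrite fps_coefM big_ord1. Qed.
Lemma fps_coefM1 f g : (f * g) 1%N = f 0%N * g 1%N + f 1%N * g 0%N.
Proof. by rewrite fps_coefM !big_ord_recl big_ord0 addr0. Qed.
Lemma fps_coef_sum (I : Type) (r : seq I) (P : pred I) (G : I -> fps R) n :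
  (\sum_(i <- r | P i) G i) n = \sum_(i <- r | P i) G i n.
Proof. exact: (big_morph (fun f : fps R => f n) (fun f g => fps_coefD f g n) (fps_coef0 n)). Qed.

Lemma fps_coefMn f k n : (f *+ k) n = f n *+ k.
Proof. by elim: k => // k IH; rewrite !mulrS fps_coefD IH. Qed.
Lemma fps_coefX0 f k : (f ^+ k) 0%N = f 0%N ^+ k.
Proof. by elim: k => // k IH; rewrite !exprS fps_coefM0 IH. Qed.
Definition fps_coefE :=
  (fps_coefD, fps_coefN, fps_coefMn, fps_coef1, fps_coefM0, fps_coefX0, fps_coefM1).

Lemma fps_powE f k : fps_pow f k = f ^+ k.
Proof. by elim: k => // k IH; rewrite exprS -IH. Qed.
Lemma fps_scaleE k f : fps_scale k f = f *+ k.
Proof. by apply: fps_ext => n; rewrite fps_coefMn. Qed.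

Local Notation t := (fps_X R : fps R).

Lemma fps_coefXM0 f : (t * f) 0%N = 0.
Proof. by rewrite fps_coefM0 mul0r. Qed.
Lemma fps_coefXM f n : (t * f) n.+1 = f n.
Proof.
rewrite fps_coefM !big_ord_recl mul0r add0r mul1r subSS subn0 big1 ?addr0 //.
by move=> i _; rewrite mul0r.
Qed.

Lemma fps_coefCM (c : R) f n : (fps_const c * f) n = c * f n.
Proof.
rewrite fps_coefM big_ord_recl subn0 big1 ?addr0 // => i _.
by rewrite mul0r.
Qed.

Lemma fps_const_monoid : monoid_morphism (@fps_const R).
Proof.
split=> // a b; apply: fps_ext => n; rewrite fps_coefCM.
by case: n => //= n; rewrite mulr0.
Qed.
Lemma fps_const_zmod : zmod_morphism (@fps_const R).
Proof.
by move=> a b; apply: fps_ext => -[|n] //; rewrite fps_coefB /= subr0.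
Qed.
HB.instance Definition _ :=
  GRing.isZmodMorphism.Build R (fps R) (@fps_const R) fps_const_zmod.
HB.instance Definition _ :=
  GRing.isMonoidMorphism.Build R (fps R) (@fps_const R) fps_const_monoid.

(** [T ^+ k] has order at least [k]; hence the finite sums in [fps_comp] and [fps_subst] lose
    nothing. *)
Lemma fps_coefX_pow (T : fps R) k n : T 0%N = 0 -> (n < k)%N -> (T ^+ k) n = 0.
Proof.
move=> T0; elim: k n => // k IH n; rewrite ltnS exprS => le_nk.
rewrite fps_coefM big1 // => -[[|i] /= lin] _; first by rewrite T0 mul0r.
rewrite IH ?mulr0 //; lia.
Qed.

Lemma fps_coefM_lt f g N n : (forall m, (m < N)%N -> f m = 0) -> (n < N)%N ->
  (f * g) n = 0.
Proof.
move=> f0 nN; rewrite fps_coefM big1 // => i _.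
by rewrite f0 ?mul0r // (leq_ltn_trans _ nN) // -ltnS.
Qed.

End SeriesRing.

(** * Coefficientwise maps and substitution of series *)

Section SeriesMap.
Variables (R S : comNzRingType) (phi : {rmorphism R -> S}).
Lemma fps_map_monoid : monoid_morphism (fps_map phi : fps R -> fps S).
Proof.
split=> [|f g]; apply: fps_ext => n; rewrite /fps_map.
  by rewrite !fps_coef1 rmorph_nat.
by rewrite !fps_coefM rmorph_sum; apply: eq_bigr => i _; rewrite rmorphM.
Qed.
Lemma fps_map_zmod : zmod_morphism (fps_map phi : fps R -> fps S).
Proof. by move=> f g; apply: fps_ext => n; apply: rmorphB. Qed.
HB.instance Definition _ :=
  GRing.isZmodMorphism.Build (fps R) (fps S) (fps_map phi) fps_map_zmod.
HB.instance Definition _ :=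
  GRing.isMonoidMorphism.Build (fps R) (fps S) (fps_map phi) fps_map_monoid.
End SeriesMap.

(* The value at [t' = T] of a series in [t'] whose coefficients are series in
   [t]; it is only meaningful when [T] has no constant term. *)
Definition fps_subst (R : comNzRingType) (T : fps R) (G : fps (fps R)) : fps R :=
  fun n => \sum_(k < n.+1) (G k * T ^+ k) n.

Section Subst.
Variables (R : comNzRingType) (T : fps R).
Hypothesis T0 : T 0%N = 0.
Implicit Types G H : fps (fps R).

Lemma fps_coef_horner_eq0 (p : {poly fps R}) N n :
  (forall k, (k < N)%N -> p`_k = 0) -> (n < N)%N -> p.[T] n = 0.
Proof.
move=> p0 nN; rewrite horner_coef fps_coef_sum big1 // => k _.
have [kN|Nk] := ltnP k N; first by rewrite p0 // mul0r.
rewrite mulrC (@fps_coefM_lt _ _ _ N) // => m mN.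
by rewrite fps_coefX_pow // (leq_trans mN).
Qed.

(** Any truncation beyond [n] gives the same coefficient, so substitution can be handled as
    evaluation of polynomials at [T]. *)
Lemma fps_substE G N n : (n < N)%N ->
  fps_subst T G n = (\poly_(k < N) G k).[T] n.
Proof.
move=> nN; rewrite horner_poly fps_coef_sum /fps_subst.
rewrite (big_ord_widen N (fun k => (G k * T ^+ k) n) nN) big_mkcond /=.
apply: eq_bigr => k _; case: ltnP => // nk.
by rewrite mulrC (@fps_coefM_lt _ _ _ n.+1) // => m mn; rewrite fps_coefX_pow //; lia.
Qed.

Lemma fps_subst_monoid : monoid_morphism (fps_subst T).
Proof.
split=> [|G H]; apply: fps_ext => n.
  rewrite /fps_subst big_ord_recl big1 ?addr0 ?mulr1 // => i _.
  by rewrite fps_coef1 mul0r.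
(* The product of the truncations and the truncation of the product differ only in degrees above
   [n], which contribute nothing to coefficient [n] after evaluation at [T]. *)
transitivity (((\poly_(k < n.+1) G k) * (\poly_(k < n.+1) H k)).[T] n).
  rewrite (@fps_substE _ n.+1) //; apply/eqP; rewrite -subr_eq0 -fps_coefB.
  rewrite -hornerN -hornerD.
  rewrite (@fps_coef_horner_eq0 _ n.+1) // => k kn.
  by rewrite coefB coef_poly kn -(fps_mulE_poly _ _ kn) subrr.
rewrite hornerM !fps_coefM; apply: eq_bigr => i _.
by rewrite -!fps_substE // ltnS leq_subr.
Qed.

Lemma fps_subst_zmod : zmod_morphism (fps_subst T).
Proof.
move=> G H; apply: fps_ext => n; rewrite fps_coefB /fps_subst -sumrB.
by apply: eq_bigr => i _; rewrite fps_coefB mulrBl.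
Qed.

Lemma fps_subst_const (c : fps R) : fps_subst T (fps_const c) = c.
Proof.
apply: fps_ext => n; rewrite /fps_subst big_ord_recl big1 ?addr0 ?mulr1 //.
by move=> i _; rewrite mul0r.
Qed.

Lemma fps_substX : fps_subst T (fps_X (fps R)) = T.
Proof.
apply: fps_ext => -[|n]; rewrite /fps_subst !big_ord_recl.
  by rewrite big_ord0 mul0r T0 addr0.
rewrite mul0r add0r mul1r expr1 big1 ?addr0 // => i _.
by rewrite /fps_X mul0r.
Qed.

(** Reading the coefficients of [U] as constant series turns the composition of the statement into a
    ring morphism in [U]. *)
Lemma fps_compE (U : fps R) :
  fps_comp U T = fps_subst T (fps_map (@fps_const R) U).
Proof.
apply: fps_ext => n; apply: eq_bigr => i _.
by rewrite fps_powE fps_coefCM.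
Qed.

End Subst.

(** Geometric series: the series with all coefficients [1] inverts one minus the variable, and the
    variable is then replaced by [1 - f], which has no constant term. *)
Lemma fps_inv (R : comNzRingType) (f : fps R) :
  f 0%N = 1 -> exists g : fps R, f * g = 1.
Proof.
move=> f0; pose T := 1 - f; have T0 : T 0%N = 0 by rewrite /T fps_coefB f0 subrr.
exists (fps_subst T (fun=> 1)).
have E : (1 - fps_X (fps R)) * (fun=> 1 : fps R) = 1 :> fps (fps R).
  rewrite mulrBl mul1r; apply: fps_ext => -[|n].
    by rewrite fps_coefB fps_coefXM0 subr0.
  by rewrite fps_coefB fps_coefXM subrr.
have [s1 sM] := fps_subst_monoid T0.
move/(congr1 (fps_subst T)): E; rewrite sM s1 => E; apply: etrans E; congr (_ * _).
by by rewrite fps_subst_zmod s1 fps_substX // /T opprB addrC subrK.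
Qed.

(** The lowest nonzero coefficients, in degrees [a] and [b], multiply to the coefficient of the
    product in degree [a + b]. *)
Lemma fps_mul_eq0 (R : idomainType) (f g : fps R) :
  f * g = 0 -> f = 0 \/ g = 0.
Proof.
move=> fg0; have [->|f0] := pselect (f = 0); [by left|].
have [->|g0] := pselect (g = 0); [by right|].
have ex (h : fps R) : h <> 0 -> exists n, h n != 0.
  move=> h0; apply: contrapT => nh; apply: h0; apply: fps_ext => n.
  by apply/eqP/negPn/negP => hn; apply: nh; exists n.
case: (ex_minnP (ex f f0)) => a fa amin; case: (ex_minnP (ex g g0)) => b gb bmin.
move/(congr1 (fun h : fps R => h (a + b)%N)): fg0; rewrite fps_coefM fps_coef0.
have lab : (a < (a + b).+1)%N by rewrite ltnS leq_addr.
rewrite (bigD1 (Ordinal lab)) //= addKn big1 ?addr0.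
  by move/eqP; rewrite mulf_eq0 (negPf fa) (negPf gb).
move=> i ia; have [lt_ia|] := ltnP i a.
  suff -> : f i = 0 by rewrite mul0r.
  by apply/eqP/negPn/negP => /amin; rewrite leqNgt lt_ia.
move=> le_ai; suff -> : g (a + b - i)%N = 0 by rewrite mulr0.
have {}ia : (i : nat) != a by apply: contraNneq ia => ia; apply/eqP/val_inj.
apply/eqP/negPn/negP => /bmin; have := ltn_ord i; lia.
Qed.

Lemma fps_mulI (R : idomainType) (f g h : fps R) : f <> 0 -> f * g = f * h -> g = h.
Proof.
move=> f0 /eqP; rewrite -subr_eq0 -mulrBr => /eqP /fps_mul_eq0 [//|/eqP].
by rewrite subr_eq0 => /eqP.
Qed.

(** * Decomposition of Tamari intervals *)

(** The first-return decomposition, for structural induction; [is_dyckP] links it to the condition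
    on prefixes. *)
Inductive dyck : seq bool -> Prop :=
| dyck_nil : dyck [::]
| dyck_node A W : dyck A -> dyck W -> dyck (true :: A ++ false :: W).

Lemma dyck_cat A B : dyck A -> dyck B -> dyck (A ++ B).
Proof.
move=> dA dB; elim: dA => //= {}A W dA _ _ dW.
by rewrite -catA; apply: dyck_node.
Qed.

(** The down-step after [A] is the first one to go below the starting height, so its position is
    determined. *)
Lemma dyck_split_inj A A' W W' : dyck A -> dyck A' ->
  A ++ false :: W = A' ++ false :: W' -> A = A' /\ W = W'.
Proof.
move=> dA; elim: dA A' W W' => [|A1 A2 dA1 IH1 dA2 IH2] A' W W' [|A1' A2' dA1' dA2'] //=.
  by case.
case; rewrite -!catA => /(IH1 _ _ _ dA1') [-> /(IH2 _ _ _ dA2') [-> ->]].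
by [].
Qed.

Fixpoint valid h (p : seq bool) : bool :=
  match p with
  | [::] => h == 0%N
  | true :: p' => valid h.+1 p'
  | false :: p' => (0 < h)%N && valid h.-1 p'
  end.

Lemma valid_cat D h p : dyck D -> valid h (D ++ p) = valid h p.
Proof.
move=> dD; elim: dD h p => //= A W _ IHA _ IHW h p.
by rewrite -catA IHA /= IHW.
Qed.

(** Cutting at the first passages to the heights [h.-1], ..., [0] is the strengthening that lets an
    induction over letters build the Dyck factors. *)
Fixpoint returns h (p : seq bool) : Prop :=
  if h is h'.+1 then exists D p', [/\ dyck D, returns h' p' & p = D ++ false :: p']
  else dyck p.

Lemma valid_returns h p : valid h p -> returns h p.
Proof.
elim: p h => [|[] p IH] h /=.
- by move/eqP->; apply: dyck_nil.
- move/IH => /= [D [p' [dD rp' ->]]].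
  case: h rp' => [|h] /=; first by move=> dp'; apply: dyck_node.
  move=> [D' [p'' [dD' rp'' ->]]]; exists (true :: D ++ false :: D'), p''.
  by split=> //=; [apply: dyck_node|rewrite -catA].
- case: h => // h /= /IH rp; exists [::], p; split=> //; exact: dyck_nil.
Qed.

Lemma dyckP p : reflect (dyck p) (valid 0 p).
Proof.
apply: (iffP idP) => [/valid_returns //|dp].
by rewrite -[p]cats0 valid_cat.
Qed.

Lemma validE h p : valid h p =
  ((h + count id p == count negb p) &&
   all (fun i => count negb (take i p) <= h + count id (take i p)) (iota 0 (size p).+1))%N.
Proof.
elim: p h => [|b p IH] h; first by rewrite /= !addn0 !andbT.
have -> : iota 0 (size (b :: p)).+1 = 0%N :: map succn (iota 0 (size p).+1).
  by rewrite -(iotaDl 1 0).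
have allS (Q : pred nat) s : all Q (0%N :: map succn s) = Q 0%N && all (Q \o succn) s.
  by rewrite /= all_map.
rewrite allS; case: b.
  rewrite [LHS]/= IH; congr (_ && _); first by rewrite /= !addnS.
  by apply: eq_all => i /=; rewrite addnS addSn.
case: h => [|h]; first by rewrite /= take0 !andbF.
by rewrite [LHS]/= IH; congr (_ && _).
Qed.

Lemma take_size_cons (T : Type) (s1 s2 : seq T) x :
  take (size s1).+1 (s1 ++ x :: s2) = rcons s1 x.
Proof. by elim: s1 => [|y s1 IH] /=; rewrite ?take0 ?IH. Qed.

Lemma drop_size_cons (T : Type) (s1 s2 : seq T) x :
  drop (size s1).+1 (s1 ++ x :: s2) = s2.
Proof. by elim: s1 => [|y s1 IH] /=; rewrite ?drop0 ?IH. Qed.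

Lemma is_dyckP p : reflect (dyck p) (is_dyck p).
Proof. by have -> : is_dyck p = valid 0 p; [rewrite validE | exact: dyckP]. Qed.

Lemma is_excursionP e :
  reflect (exists2 D, dyck D & e = true :: rcons D false) (is_excursion e).
Proof.
apply: (iffP idP) => [|[D dD ->]].
  case: e => // b e /and3P[_ bal /allP pos].
  have e_gt0 : (0 < size e)%N by case: (e) bal; case: (b).
  case: b bal pos => bal pos; last first.
    by have := pos 1%N; rewrite mem_iota /= take0 add1n ltnS e_gt0 => /(_ isT).
  have /valid_returns [D [D' [dD dD' Ee]]] : valid 1 e.
    rewrite validE -[(1 + _)%N]/(count id (true :: e)) (eqP bal) eqxx.
    apply/allP => i; rewrite mem_iota add0n ltnS => /= le_i.
    have [lt_i|ge_i] := ltnP i (size e).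
      by have := pos i.+1; rewrite mem_iota /= add1n ltnS lt_i add0n => /(_ isT)/ltnW.
    by rewrite take_oversize // -[(1 + _)%N]/(count id (true :: e)) (eqP bal).
  exists D => //; case: D' dD' Ee => [_ ->|b D' _ Ee]; first by rewrite cats1.
  (* If letters remained after [u D d], this proper prefix would already be balanced. *)
  have memD : (size D).+2 \in iota 1 (size (true :: e)).-1.
    by rewrite mem_iota /= Ee size_cat /=; lia.
  have := pos _ memD; rewrite Ee [take _ _]/=.
  rewrite take_size_cons -cats1.
  move: dD => /is_dyckP /andP[/eqP balD _].
  by rewrite /= !count_cat /= balD !addn0 add0n addn1 add1n ltnn.
move: dD => /is_dyckP /andP[/eqP bal /allP pos].
rewrite /is_excursion /balanced /= -cats1 !count_cat /= bal addn1 add0n.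
rewrite add1n addn0 eqxx /=.
apply/allP => i; rewrite mem_iota size_cat /= add1n ltnS addn1.
case: i => // i; rewrite ltnS /= => le_i; rewrite add0n add1n ltnS.
rewrite takel_cat //; apply: pos; by rewrite mem_iota.
Qed.

(** * The Tamari order as chains of rotations *)

Inductive rotation : seq bool -> seq bool -> Prop :=
  Rotation a D b : dyck D ->
    rotation (a ++ false :: true :: D ++ false :: b)
             (a ++ true :: D ++ false :: false :: b).

(** The excursion [u D d] satisfies the minimality clause because its proper nonempty prefixes stay
    strictly above their start, so none of them is balanced. *)
Lemma tamari_stepP p q : reflect (rotation p q) (tamari_step p q).
Proof.
apply: (iffP existsP) => [[j /existsP[k /and5P[/eqP pj _ le_jk ex /andP[_ /eqP ->]]]]|].
  have [D dD ED] := is_excursionP _ ex.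
  have Ep : p = take j p ++ false :: true :: D ++ false :: drop (j.+1 + k) p.
    rewrite -{1}(cat_take_drop j p) (drop_nth false) // pj.
    by rewrite -{1}(cat_take_drop k (drop j.+1 p)) ED drop_drop (addnC k) /= cat_rcons.
  by rewrite {1}Ep ED /= cat_rcons; apply: Rotation.
case=> a D b dD; set p' := _ ++ _.
have lt_j : (size a < size p')%N by rewrite size_cat /= addnS ltnS leq_addr.
have lt_k : ((size D).+2 < (size p').+1)%N.
  rewrite size_cat /= size_cat /=; lia.
exists (Ordinal lt_j); apply/existsP; exists (Ordinal lt_k) => /=.
have Ed : drop (size a).+1 p' = true :: D ++ false :: b.
  exact: drop_size_cons.
have Et : take (size D).+2 (true :: D ++ false :: b) = true :: rcons D false.
  by rewrite [LHS]/= take_size_cons.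
have exD : is_excursion (true :: rcons D false) by apply/is_excursionP; exists D.
rewrite Ed Et take_size_cat //.
rewrite -[(_.+1 + _)%N]addnC -drop_drop Ed.
apply/and5P; split=> //.
- by rewrite nth_cat ltnn subnn.
- by rewrite nth_cat ltnNge leqnSn /= subSnn.
- rewrite size_cat /= size_cat /=; lia.
apply/andP; split.
  apply/forallP => k'; apply/negP => ex'.
  case/and3P: exD => _ _ /allP/(_ k'); rewrite mem_iota /= size_rcons.
  have /and3P[k'0 /eqP bal _] := ex'.
  have Ek : take k' (true :: rcons D false) = take k' (true :: D ++ false :: b).
    by rewrite -Et take_takel // ltnW.
  rewrite Ek bal ltnn ltn_ord andbT => H.
  suff: (0 < k')%N by move/H.
  by case: (nat_of_ord k') k'0; rewrite ?take0.
by rewrite /= drop_size_cons cat_rcons.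
Qed.

Inductive tle : seq bool -> seq bool -> Prop :=
| tle_refl p : tle p p
| tle_step p q r : rotation p q -> tle q r -> tle p r.

Lemma tle_trans q p r : tle p q -> tle q r -> tle p r.
Proof. by elim=> // {}p p' {}q pp' _ IH /IH; apply: tle_step. Qed.

Lemma tle_ctx a b p q : tle p q -> tle (a ++ p ++ b) (a ++ q ++ b).
Proof.
elim=> [r|{}p r s [a' D b' dD] _ IH]; first exact: tle_refl.
apply: tle_step IH; rewrite -!catA /= -!catA /= ![a ++ a' ++ _]catA.
exact: Rotation.
Qed.

Lemma size_rotation p q : rotation p q -> size q = size p.
Proof. by case=> a D b _; rewrite !size_cat /= !size_cat /=; lia. Qed.

Lemma size_tle p q : tle p q -> size q = size p.
Proof. by elim=> // {}p q' r /size_rotation <- _. Qed.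

Lemma tamari_leP n (P Q : word n) : reflect (tle P Q) (tamari_le P Q).
Proof.
apply: (iffP connectP) => [[s]|le_PQ].
  elim: s P => [|P' s IH] P /=; first by move=> _ ->; apply: tle_refl.
  by case/andP=> /tamari_stepP PP' /IH H /H; apply: tle_step.
(* Rotations preserve length, so every intermediate word of a chain is again a tuple of size
   [n.*2]. *)
have lift p q : tle p q -> forall P Q : word n, val P = p -> val Q = q ->
    connect (fun P' Q' : word n => tamari_step P' Q') P Q.
  elim=> [r|{}p r {}q pr _ IH] P' Q' Pp Qq.
    by rewrite (_ : Q' = P') ?connect0 //; apply: val_inj; rewrite /= Pp.
  have sz : size r == n.*2 by rewrite (size_rotation pr) -Pp size_tuple.
  apply: connect_trans (IH (Tuple sz) Q' erefl Qq); apply: connect1.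
  by apply/tamari_stepP; rewrite Pp.
by apply/connectP; apply: lift le_PQ _ _ erefl erefl.
Qed.

Lemma tle_node_mono A A' B B' : tle A A' -> tle B B' ->
  tle (true :: A ++ false :: B) (true :: A' ++ false :: B').
Proof.
move=> leA leB; apply: (tle_trans (q := true :: A' ++ false :: B)).
  exact: (tle_ctx [:: true] (false :: B) leA).
by have := tle_ctx (true :: A' ++ [:: false]) [::] leB; rewrite /= !cats0 -!catA.
Qed.

Lemma rotation_tle p q : rotation p q -> tle p q.
Proof. by move=> r; apply: tle_step r (tle_refl _). Qed.

(* The cut [A ++ B] marks a contact of the lower path of the first sub-interval. *)
Inductive tle_node (Q1 Q2 : seq bool) : seq bool -> Prop :=
  TleNode A B P2 : dyck A -> dyck B -> dyck P2 -> tle (A ++ B) Q1 -> tle P2 Q2 ->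
    tle_node Q1 Q2 (true :: A ++ false :: B ++ P2).

(** The down-step passes the primitive factors of [B] one after the other, each passage being one
    rotation. *)
Lemma tle_shift A B : dyck B ->
  tle (true :: A ++ false :: B) (true :: A ++ B ++ [:: false]).
Proof.
move=> dB; elim: dB A => [|B1 B2 dB1 _ _ IH] A; first exact: tle_refl.
apply: tle_step (Rotation (true :: A) B2 dB1) _.
have := IH (A ++ true :: B1 ++ [:: false]).
by rewrite /= -!catA /= -!catA.
Qed.

Lemma tle_node_tle P Q1 Q2 : tle_node Q1 Q2 P -> tle P (true :: Q1 ++ false :: Q2).
Proof.
case=> A B P2 dA dB dP2 leAB leP2.
have := tle_ctx [::] P2 (tle_shift A dB); rewrite /= -!catA /= => /tle_trans; apply.
rewrite catA; exact: tle_node_mono.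
Qed.

Lemma rotation_dyck p q : rotation p q -> dyck p -> dyck q.
Proof.
case=> a D b dD /dyckP H; apply/dyckP; move: H.
suff: forall h, valid h (a ++ false :: true :: D ++ false :: b) ->
    valid h (a ++ true :: D ++ false :: false :: b) by apply.
move=> h; elim: a h => [|[] a IH] h /=.
- by case: h => // h; rewrite !valid_cat.
- exact: IH.
- by case/andP=> -> /IH.
Qed.

(* Rotations of Dyck words, sorted by the position of the down-step with
   respect to the first return. *)
Inductive drot : seq bool -> seq bool -> Prop :=
| drot_in A A' W : dyck A -> dyck A' -> rotation A A' -> dyck W ->
    drot (true :: A ++ false :: W) (true :: A' ++ false :: W)
| drot_at A D W : dyck A -> dyck D -> dyck W ->
    drot (true :: A ++ false :: true :: D ++ false :: W)
         (true :: (A ++ true :: D ++ [:: false]) ++ false :: W)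
| drot_out A W W' : dyck A -> dyck W -> rotation W W' ->
    drot (true :: A ++ false :: W) (true :: A ++ false :: W').

Lemma valid_catr h a p : valid h (a ++ p) -> exists h', valid h' p.
Proof.
elim: a h => [|[] a IH] h /=; first by exists h.
  exact: IH.
by case/andP => _ /IH.
Qed.

Lemma cat_cons_cases (T : Type) (x : T) a s b t : a ++ x :: s = b ++ x :: t ->
  [\/ a = b /\ s = t,
      exists2 c, b = a ++ x :: c & s = c ++ x :: t
    | exists2 c, a = b ++ x :: c & t = c ++ x :: s].
Proof.
elim: a b => [|y a IH] [|z b] /= [].
- by move=> ->; apply: Or31.
- by move=> -> ->; apply: Or32; exists b.
- by move=> -> <-; apply: Or33; exists a.
move=> -> /IH [[-> ->]|[c -> ->]|[c -> ->]].
- exact: Or31.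
- by apply: Or32; exists c.
- by apply: Or33; exists c.
Qed.

Lemma rotation_drot p q : dyck p -> rotation p q -> drot p q.
Proof.
move=> dp; case: dp => [|A W dA dW].
  move Ep: [::] => p' rot; by case: rot Ep => -[].
move Ep: (true :: A ++ false :: W) => p' rot.
case: rot Ep => a D b dD E; rewrite -E; case: a E => [|u a] //= [<- E].
case: (cat_cons_cases (esym E)) => {E} [[-> EW]|[c EA Ec]|[c -> EW]].
- move: dW; rewrite -EW => dW.
  have {}dW : dyck b.
    by move: dW => /dyckP; rewrite /= valid_cat //= => /dyckP.
  have -> : true :: A ++ true :: D ++ [:: false, false & b] =
            true :: (A ++ true :: D ++ [:: false]) ++ false :: b.
    by rewrite /= -!catA /= -!catA.
  exact: drot_at.
- move: dA; rewrite EA => dA.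
  case: c Ec EA dA => [|[] c] //= [Ec] EA dA.
  (* Since [A] is a Dyck word, what remains of it must come down below the start of [D]: the moved
     excursion ends inside [A]. *)
  have /= [h /valid_returns /= [D' [r [dD' _ Ec']]]] : exists h, valid h.+1 c.
    move/dyckP: dA => /valid_catr [h] /= /andP[_ ?]; by exists h.-1.
  move: Ec; rewrite Ec' -catA /= => /(dyck_split_inj dD dD') [ED ->].
  rewrite -ED in Ec' *.
  have rA : rotation (a ++ [:: false, true & D ++ false :: r])
                     (a ++ true :: D ++ [:: false, false & r]).
    exact: Rotation.
  rewrite Ec' in dA.
  have -> : true :: a ++ true :: D ++ [:: false, false & r ++ false :: W] =
    true :: (a ++ true :: D ++ [:: false, false & r]) ++ false :: W.
    by rewrite /= -!catA /= -!catA.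
  by apply: drot_in => //; apply: rotation_dyck rA dA.
- rewrite EW -catA; apply: drot_out; rewrite -?EW //.
  by rewrite EW; apply: Rotation.
Qed.

(** In the target of a rotation the factor [u D d d] ends below its start, so it cannot straddle the
    contact between [B] and [P2]. Undoing the rotation therefore acts inside one of the two
    words. *)
Lemma rotation_cat W B P2 : dyck B -> dyck P2 -> dyck W -> rotation W (B ++ P2) ->
  exists B0 P0, [/\ W = B0 ++ P0, dyck B0, dyck P0, tle B0 B & tle P0 P2].
Proof.
move=> dB; elim: dB W => [|A B1 dA _ dB1 IH] W dP2 dW rot.
  exists [::], W; split=> //; [exact: dyck_nil | exact: tle_refl |].
  by apply: tle_step rot (tle_refl _).
have {rot} := rotation_drot dW rot; rewrite /= -catA /=.
set q := true :: _; move Eq: q => q' rot; rewrite {}/q in Eq.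
case: rot Eq => [A0 A' W0 dA0 dA' rA dW0|A0 D W0 dA0 dD dW0|A0 W0 W' dA0 dW0 rW] [] E.
- have [EA EW] := dyck_split_inj dA dA' E; rewrite -{}EA in rA dA'.
  exists (true :: A0 ++ false :: B1), P2; split=> //.
  + by rewrite -EW /= -catA.
  + exact: dyck_node.
  + exact: tle_node_mono (rotation_tle rA) (tle_refl _).
  + exact: tle_refl.
- have dA0D : dyck (A0 ++ true :: D ++ [:: false]).
    by apply: dyck_cat dA0 (dyck_node dD dyck_nil).
  have [EA EW] := dyck_split_inj dA dA0D E; rewrite EA.
  exists (true :: A0 ++ false :: true :: D ++ false :: B1), P2; split=> //.
  + by rewrite -EW /= -!catA /= -!catA.
  + exact: dyck_node dA0 (dyck_node dD dB1).
  + apply: rotation_tle; have := Rotation (true :: A0) B1 dD.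
    by rewrite /= -!catA /= -!catA.
  + exact: tle_refl.
- have [EA EW] := dyck_split_inj dA dA0 E; rewrite -EW in rW.
  have [B0 [P0 [-> dB0 dP0 leB leP]]] := IH _ dP2 dW0 rW.
  exists (true :: A0 ++ false :: B0), P0; split=> //.
  + by rewrite /= -catA.
  + exact: dyck_node.
  + by rewrite EA; apply: tle_node_mono (tle_refl _) leB.
Qed.

(** The form [u A d B P2] is pulled back through the chain one rotation at a time, starting from [R]
    with [B] empty. *)
Lemma tle_tle_node P R Q1 Q2 : tle P R -> dyck P -> dyck Q1 -> dyck Q2 ->
  R = true :: Q1 ++ false :: Q2 -> tle_node Q1 Q2 P.
Proof.
elim=> [{}P|{}P P' {}R rP _ IH] dP dQ1 dQ2 ER.
  have -> : P = true :: Q1 ++ false :: [::] ++ Q2 by [].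
  by apply: TleNode; rewrite ?cats0 //; solve [exact: dyck_nil | exact: tle_refl].
have {IH} := IH (rotation_dyck rP dP) dQ1 dQ2 ER.
have := rotation_drot dP rP; move=> {rP dP ER R} rP H.
case: H rP => A B P2 dA dB dP2 leAB leP2; set q := true :: _.
move Eq: q => q' rot; rewrite {}/q in Eq.
case: rot Eq => [A0 A' W dA0 dA' rA dW|A0 D W dA0 dD dW|A0 W W' dA0 dW rW] [] E.
- have [EA EW] := dyck_split_inj dA dA' E; rewrite -EW.
  apply: TleNode => //; apply: tle_trans leAB; rewrite EA.
  exact: (tle_ctx [::] B (rotation_tle rA)).
(* Undoing a rotation at the first return moves the last primitive factor [u D d] of [A] to the
   front of [B]; the word [A ++ B] does not change. *)
- have dA0D : dyck (A0 ++ true :: D ++ [:: false]).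
    by apply: dyck_cat dA0 (dyck_node dD dyck_nil).
  have [EA EW] := dyck_split_inj dA dA0D E; rewrite -EW.
  have -> : true :: A0 ++ [:: false, true & D ++ false :: B ++ P2] =
    true :: A0 ++ false :: (true :: D ++ false :: B) ++ P2 by rewrite /= -catA.
  apply: TleNode => //; first exact: dyck_node.
  by move: leAB; rewrite EA /= -!catA /= -!catA.
- have [EA EW] := dyck_split_inj dA dA0 E; rewrite -EW in rW; rewrite -EA.
  have [B0 [P0 [-> dB0 dP0 leB leP]]] := rotation_cat dB dP2 dW rW.
  apply: TleNode => //; last exact: tle_trans leP leP2.
  apply: tle_trans leAB; have := tle_ctx A [::] leB; by rewrite !cats0.
Qed.

Lemma tle_nodeP P Q1 Q2 : dyck P -> dyck Q1 -> dyck Q2 ->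
  tle P (true :: Q1 ++ false :: Q2) <-> tle_node Q1 Q2 P.
Proof.
by move=> dP dQ1 dQ2; split=> [/tle_tle_node|]; [apply | apply: tle_node_tle].
Qed.

(** * Contacts, heights and the recurrences *)

(* The starting point is not counted as a contact. *)
Fixpoint contacts h (p : seq bool) : nat :=
  match p with
  | [::] => 0
  | true :: p' => contacts h.+1 p'
  | false :: p' => (h == 1) + contacts h.-1 p'
  end%N.

Lemma contacts_cat_pos D h p : dyck D -> contacts h.+1 (D ++ p) = contacts h.+1 p.
Proof.
move=> dD; elim: dD h p => //= A W _ IHA _ IHW h p.
by rewrite -catA IHA /= IHW.
Qed.

Lemma contacts_node A W : dyck A ->
  contacts 0 (true :: A ++ false :: W) = (contacts 0 W).+1.
Proof. by move=> dA; rewrite /= contacts_cat_pos. Qed.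

Lemma contacts_cat A B : dyck A -> contacts 0 (A ++ B) = (contacts 0 A + contacts 0 B)%N.
Proof.
elim=> // {}A W dA _ _ IH.
by rewrite (_ : _ ++ B = true :: A ++ false :: (W ++ B)) ?contacts_node ?IH //= -catA.
Qed.

Definition cuts (p : seq bool) : seq (seq bool * seq bool) :=
  [seq (take j p, drop j p) |
     j <- [seq j <- iota 0 (size p).+1 | is_dyck (take j p) && is_dyck (drop j p)]].

Lemma mem_cuts p c :
  reflect [/\ dyck c.1, dyck c.2 & c.1 ++ c.2 = p] (c \in cuts p).
Proof.
apply: (iffP mapP) => [[j]|[d1 d2 <-]].
  rewrite mem_filter => /andP[/andP[/is_dyckP d1 /is_dyckP d2] _ ->] /=.
  by rewrite cat_take_drop.
exists (size c.1); last by rewrite take_size_cat ?drop_size_cat //; case: (c).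
rewrite mem_filter take_size_cat ?drop_size_cat // mem_iota size_cat ltnS leq_addr.
by rewrite !andbT; apply/andP; split; apply/is_dyckP.
Qed.

Lemma cuts_uniq p : uniq (cuts p).
Proof.
rewrite map_inj_in_uniq ?filter_uniq ?iota_uniq // => i j.
rewrite !mem_filter !mem_iota !ltnS => /andP[_ /= le_i] /andP[_ /= le_j] [/(congr1 size)].
by rewrite !size_takel.
Qed.

Lemma perm_cuts_node A W : dyck A -> dyck W ->
  perm_eq (cuts (true :: A ++ false :: W))
    (([::], true :: A ++ false :: W) ::
     [seq (true :: A ++ false :: c.1, c.2) | c <- cuts W]).
Proof.
move=> dA dW; apply: uniq_perm; first exact: cuts_uniq.
  rewrite /= map_inj_uniq ?cuts_uniq; last first.
    by case=> [c1 c2] [c1' c2'] /= [/eqP]; rewrite eqseq_cat // => /andP[_ /eqP[->]] ->.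
  by rewrite andbT; apply/mapP => -[].
move=> [c1 c2]; rewrite inE; apply/mem_cuts/orP => /= [[d1 d2]|].
  case: d1 => [/= ->|A' W' dA' dW' /=]; first by left.
  rewrite -catA => -[] /(dyck_split_inj dA' dA)[-> EW]; right.
  by apply/mapP; exists (W', c2) => //; apply/mem_cuts.
case=> [/eqP[-> ->]|]; first by split=> //; [exact: dyck_nil | exact: dyck_node].
case/mapP=> -[c1' c2'] /mem_cuts[/= d1 d2 <-] [-> ->]; split=> //.
  exact: dyck_node.
by rewrite /= -catA.
Qed.

(** * Contact and height weights of a single path *)

Section Weights.
Variable S : comNzRingType.

(** There is one cut at the start and one at each contact, and the right parts have [0], ...,
    [contacts 0 p] contacts: the sum is geometric. *)
Lemma sum_cuts (x : S) p : dyck p ->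
  (x - 1) * (\sum_(c <- cuts p) x ^+ contacts 0 c.2) = x ^+ (contacts 0 p).+1 - 1.
Proof.
elim=> [|A W dA _ dW IH].
  by rewrite /cuts /= big_seq1 /= mulr1.
rewrite (perm_big _ (perm_cuts_node dA dW)) big_cons big_map mulrDr IH /=.
rewrite contacts_cat_pos //= add1n !exprS; ring.
Qed.

Fixpoint height_sum (s : S) h (p : seq bool) : S :=
  s ^+ h + match p with
           | [::] => 0
           | true :: p' => height_sum s h.+1 p'
           | false :: p' => height_sum s h.-1 p'
           end.

(** The junction point is counted in both [D] and [p], hence the extra [s ^+ h]. *)
Lemma height_sum_cat s D h p : dyck D ->
  height_sum s h (D ++ p) + s ^+ h = s ^+ h * height_sum s 0 D + height_sum s h p.
Proof.
move=> dD; elim: dD h p => [|A W _ IHA _ IHW] h p /=.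
  by rewrite addr0 mulr1 addrC.
have E1 := IHA h.+1 (false :: W ++ p); have E2 := IHW h p.
have E3 := IHA 1%N (false :: W).
rewrite -catA /=.
move/(canRL (addrK _)): E1 => ->; move/(canRL (addrK _)): E3 => ->.
move/(canRL (addrK _)): E2 => /= ->.
rewrite !exprS !expr0; ring.
Qed.

(** The three terms come from the starting point, from [A] lifted by one level, and from [W] at the
    first return onwards. *)
Lemma height_sum_node s A W : dyck A ->
  height_sum s 0 (true :: A ++ false :: W) = 1 + s * height_sum s 0 A + height_sum s 0 W.
Proof.
move=> dA /=; have /(canRL (addrK _)) -> := height_sum_cat s 1 (false :: W) dA.
rewrite /= expr0 expr1; ring.
Qed.

Lemma sum_height_valid s h p : valid h p ->
  \sum_(i < (size p).+1) s ^+ (h + count id (take i p) - count negb (take i p))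
  = height_sum s h p.
Proof.
elim: p h => [|b p IH] h /=.
  by rewrite big_ord1 addr0 addn0 subn0.
rewrite big_ord_recl /= addn0 subn0 => vp; congr (_ + _).
case: b vp => /= [|/andP[h0]] /IH <-; apply: eq_bigr => i _; congr (_ ^+ _); rewrite /= !add0n; lia.
Qed.

Lemma sum_height s p : dyck p ->
  \sum_(i < (size p).+1) s ^+ height p i = height_sum s 0 p.
Proof. by move/dyckP/sum_height_valid <-. Qed.

End Weights.

(** * Bijection between intervals and their decompositions *)

Definition intervals n : seq (seq bool * seq bool) :=
  [seq (val R.1, val R.2) | R <- enum [pred R : word n * word n |
     is_dyck R.1 && (is_dyck R.2 && tamari_le R.1 R.2)]].

Lemma mem_intervals n P Q :
  reflect [/\ size P = n.*2, dyck P, dyck Q & tle P Q] ((P, Q) \in intervals n).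
Proof.
apply: (iffP mapP) => [[[P' Q']]|[sP dP dQ le]].
  rewrite mem_enum inE /= => /and3P[/is_dyckP dP /is_dyckP dQ /tamari_leP le] [-> ->].
  by rewrite size_tuple.
have sQ : size Q = n.*2 by rewrite (size_tle le).
exists (Tuple (introT eqP sP), Tuple (introT eqP sQ)) => //.
by rewrite mem_enum inE /=; apply/and3P; split; [exact/is_dyckP|exact/is_dyckP|exact/tamari_leP].
Qed.

Lemma intervals_uniq n : uniq (intervals n).
Proof.
rewrite map_inj_uniq ?enum_uniq // => -[P Q] [P' Q'] /= [EP EQ].
by congr (_, _); apply: val_inj.
Qed.

Definition cut_intervals k : seq (seq bool * seq bool * seq bool) :=
  [seq (c, R.2) | R <- intervals k, c <- cuts R.1].

Lemma mem_cut_intervals k A B Q :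
  reflect [/\ dyck A, dyck B, (A ++ B, Q) \in intervals k & dyck Q]
          ((A, B, Q) \in cut_intervals k).
Proof.
apply: (iffP allpairsPdep) => [[[P Q'] [c [memR /mem_cuts /= [d1 d2 E] [Ec ->]]]]|].
  rewrite -Ec /= in d1 d2 E; rewrite -E in memR.
  by have /mem_intervals[_ _ dQ _] := memR.
case=> dA dB memAB _; exists (A ++ B, Q), (A, B); split=> //.
by apply/mem_cuts.
Qed.

Lemma cut_intervals_uniq k : uniq (cut_intervals k).
Proof.
apply: allpairs_uniq_dep; first exact: intervals_uniq.
  by move=> R _; apply: cuts_uniq.
have cat_d (d : {x : seq bool * seq bool & (seq bool * seq bool)%type}) :
    d \in [seq existT (fun=> _) x y | x <- intervals k, y <- cuts x.1] ->
    (tagged d).1 ++ (tagged d).2 = (tag d).1.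
  by move=> /allpairsPdep [R [c [_ /mem_cuts[_ _ E] ->]]].
move=> [[P Q] c] [[P' Q'] c'] /cat_d /= <- /cat_d /= <- [-> ->].
by [].
Qed.

Lemma dyck_size p : dyck p -> exists k, size p = k.*2.
Proof.
elim=> [|A W _ [k Ek] _ [l El]]; first by exists 0%N.
by exists (k + l).+1; rewrite /= size_cat /= Ek El; lia.
Qed.

Definition glue (d : (seq bool * seq bool * seq bool) * (seq bool * seq bool)) :=
  (true :: d.1.1.1 ++ false :: d.1.1.2 ++ d.2.1, true :: d.1.2 ++ false :: d.2.2).

Definition decompositions n :=
  [seq d | k <- iota 0 n.+1,
           d <- [seq (m, R) | m <- cut_intervals k, R <- intervals (n - k)]].

Lemma mem_decompositions n A B Q1 P2 Q2 :
  reflect [/\ [/\ dyck A, dyck B, dyck Q1 & tle (A ++ B) Q1],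
              [/\ dyck P2, dyck Q2 & tle P2 Q2] &
              (size A + size B + size P2 = n.*2)%N]
          ((A, B, Q1, (P2, Q2)) \in decompositions n).
Proof.
apply: (iffP allpairsPdep) => [[k [d [kn mem_d Ed]]]|[[dA dB dQ1 le1] [dP2 dQ2 le2] sz]].
  move: mem_d; rewrite -Ed => /allpairsPdep [m [R [mem_m mem_R [Em ER]]]].
  move: mem_m mem_R; rewrite -Em -ER.
  move=> /mem_cut_intervals[dA dB /mem_intervals[sz _ dQ1 le1] _].
  move=> /mem_intervals[sz2 dP2 dQ2 le2].
  move: kn; rewrite mem_iota add0n ltnS => /= kn.
  by split=> //; rewrite -size_cat sz sz2 -doubleD subnKC.
have [k szAB] : exists k, size (A ++ B) = k.*2 := dyck_size (dyck_cat dA dB).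
have kn : (k <= n)%N by move: szAB; rewrite size_cat; lia.
exists k, (A, B, Q1, (P2, Q2)); rewrite mem_iota ltnS; split=> //.
apply/allpairsPdep; exists (A, B, Q1), (P2, Q2); split=> //.
  apply/mem_cut_intervals; split=> //; apply/mem_intervals; split=> //.
  exact: dyck_cat.
by apply/mem_intervals; split=> //; move: szAB; rewrite size_cat; lia.
Qed.

Lemma decompositions_uniq n : uniq (decompositions n).
Proof.
apply: allpairs_uniq_dep; first exact: iota_uniq.
  move=> k _; apply: allpairs_uniq; rewrite ?cut_intervals_uniq ?intervals_uniq //.
  by move=> [? ?] [? ?] _ _ [-> ->].
(* The index of the outer sum is recovered as the half-length of [Q1]. *)
have size_d (d : {x : nat & (seq bool * seq bool * seq bool * (seq bool * seq bool))%type}) :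
    d \in [seq existT (fun=> _) x y | x <- iota 0 n.+1,
      y <- [seq (m, R) | m <- cut_intervals x, R <- intervals (n - x)]] ->
    (size (tagged d).1.2)./2 = tag d.
  move=> /allpairsPdep [k [d1 [_ + ->]]] /= => /allpairsPdep [[[A B] Q] [R [+ _ ->]]] /=.
  by move=> /mem_cut_intervals[_ _ /mem_intervals[sz _ _ /size_tle ->] _]; rewrite sz doubleK.
by move=> [k d] [k' d'] /size_d /= Ek /size_d /= <- Ed; rewrite -Ek -Ed.
Qed.

Lemma perm_intervals n :
  perm_eq (intervals n.+1) [seq glue d | d <- decompositions n].
Proof.
apply: uniq_perm; first exact: intervals_uniq.
  rewrite map_inj_in_uniq ?decompositions_uniq //.
  move=> [[[A B] Q1] [P2 Q2]] [[[A' B'] Q1'] [P2' Q2']].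
  move=> /mem_decompositions[[dA dB dQ1 /size_tle le1] [dP2 dQ2 _] _].
  move=> /mem_decompositions[[dA' dB' dQ1' /size_tle le1'] [dP2' dQ2' _] _].
  rewrite /glue /= => -[E EQ].
  have [EA EBP] := dyck_split_inj dA dA' E.
  have [EQ1 ->] := dyck_split_inj dQ1 dQ1' EQ.
  (* [A ++ B] has the length of [Q1], which fixes where [B] ends and [P2] begins. *)
  have szB : size B = size B' by move: le1; rewrite EQ1 le1' EA !size_cat => /addnI.
  by move/eqP: EBP; rewrite eqseq_cat // EA EQ1 => /andP[/eqP -> /eqP ->].
move=> [P Q]; apply/mem_intervals/mapP => [[sz dP dQ lePQ]|].
  case: dQ lePQ => [/size_tle|Q1 Q2 dQ1 dQ2 lePQ]; first by rewrite sz.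
  have := proj1 (tle_nodeP dP dQ1 dQ2) lePQ; move=> nodeP.
  case: nodeP sz dP {lePQ} => A B P2 dA dB dP2 le1 le2 sz _.
  exists (A, B, Q1, (P2, Q2)) => //; apply/mem_decompositions; split=> //.
  by move: sz; rewrite /= size_cat /= size_cat; lia.
case=> -[[[A B] Q1] [P2 Q2]] /mem_decompositions[[dA dB dQ1 le1] [dP2 dQ2 le2] sz].
rewrite /glue /= => -[-> ->]; split.
- by rewrite /= size_cat /= size_cat; lia.
- by apply: dyck_node => //; apply: dyck_cat.
- exact: dyck_node.
- by apply: tle_node_tle; apply: TleNode.
Qed.

(** * Recurrences for the coefficients *)

Section GeneratingFunctions.
Variables (S : comNzRingType) (s x : S).

Definition Fcoef (y : S) n : S := \sum_(R <- intervals n) y ^+ contacts 0 R.1.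
Definition Hcoef (y : S) n : S :=
  \sum_(R <- intervals n) y ^+ contacts 0 R.1 * height_sum s 0 R.2.

(** In [u A d B P2] the part [A] is lifted off the axis, so only the contacts of [B] are
    weighted. *)
Definition Mcoef k : S := \sum_(m <- cut_intervals k) x ^+ contacts 0 m.1.2.
Definition Ncoef k : S := \sum_(m <- cut_intervals k) x ^+ contacts 0 m.1.2 * height_sum s 0 m.2.

(** By [sum_cuts], summing over the cuts produces a divided difference between [x] and [1]; it is
    kept multiplied out because [S] is only a ring. *)
Lemma sum_cut_intervals (G : seq bool -> S) k :
  (x - 1) * (\sum_(m <- cut_intervals k) x ^+ contacts 0 m.1.2 * G m.2) =
  x * (\sum_(R <- intervals k) x ^+ contacts 0 R.1 * G R.2) -
  \sum_(R <- intervals k) G R.2.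
Proof.
rewrite big_allpairs_dep mulr_sumr mulr_sumr -sumrB /=; apply: eq_big_seq => -[P Q] /=.
move=> /mem_intervals[_ dP _ _].
rewrite -mulr_suml mulrA sum_cuts // exprS; ring.
Qed.

Lemma sum_intervalsS (G : seq bool -> seq bool -> S) n :
  \sum_(R <- intervals n.+1) G R.1 R.2 =
  \sum_(k < n.+1) \sum_(m <- cut_intervals k) \sum_(R <- intervals (n - k))
    G (true :: m.1.1 ++ false :: m.1.2 ++ R.1) (true :: m.2 ++ false :: R.2).
Proof.
rewrite (perm_big _ (perm_intervals n)) big_map big_allpairs_dep /=.
rewrite -(big_mkord xpredT (fun k => \sum_(m <- cut_intervals k)
  \sum_(R <- intervals (n - k)) G (true :: m.1.1 ++ false :: m.1.2 ++ R.1)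
    (true :: m.2 ++ false :: R.2))) /index_iota subn0.
by apply: eq_bigr => k _; rewrite big_allpairs.
Qed.

Lemma McoefE k : (x - 1) * Mcoef k = x * Fcoef x k - Fcoef 1 k.
Proof.
have -> : Mcoef k = \sum_(m <- cut_intervals k) x ^+ contacts 0 m.1.2 * 1.
  by apply: eq_bigr => m _; rewrite mulr1.
rewrite (sum_cut_intervals (fun=> 1)); congr (x * _ - _).
  by apply: eq_bigr => R _; rewrite mulr1.
by apply: eq_bigr => R _; rewrite expr1n.
Qed.

Lemma NcoefE k : (x - 1) * Ncoef k = x * Hcoef x k - Hcoef 1 k.
Proof.
rewrite /Ncoef (sum_cut_intervals (height_sum s 0)); congr (_ - _).
by apply: eq_bigr => R _; rewrite expr1n mul1r.
Qed.

Lemma FcoefS n : Fcoef x n.+1 = x * \sum_(k < n.+1) Mcoef k * Fcoef x (n - k).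
Proof.
rewrite /Fcoef (sum_intervalsS (fun P _ => x ^+ contacts 0 P)) mulr_sumr.
apply: eq_bigr => k _; rewrite mulr_suml mulr_sumr.
apply: eq_big_seq => -[[A B] Q1] /mem_cut_intervals[dA dB _ _].
rewrite !mulr_sumr; apply: eq_bigr => -[P2 Q2] _.
by rewrite contacts_node // contacts_cat // exprS exprD.
Qed.

(** The three summands are those of [height_sum_node] for the upper path: starting point, lifted
    heights of [Q1], heights of [Q2]. *)
Lemma HcoefS n : Hcoef x n.+1 = x * \sum_(k < n.+1)
  (Mcoef k * Fcoef x (n - k) + s * (Ncoef k * Fcoef x (n - k)) +
   Mcoef k * Hcoef x (n - k)).
Proof.
rewrite /Hcoef (sum_intervalsS (fun P Q => x ^+ contacts 0 P * height_sum s 0 Q)).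
rewrite mulr_sumr; apply: eq_bigr => k _; rewrite !mulr_suml !mulr_sumr -!big_split mulr_sumr.
apply: eq_big_seq => -[[A B] Q1] /mem_cut_intervals[dA dB _ dQ1].
rewrite !mulr_sumr -!big_split mulr_sumr; apply: eq_bigr => -[P2 Q2] _.
rewrite contacts_node // height_sum_node // contacts_cat // exprS exprD /=; ring.
Qed.

Lemma perm_intervals0 : perm_eq (intervals 0) [:: ([::], [::])].
Proof.
apply: uniq_perm; rewrite ?intervals_uniq // => -[P Q]; rewrite inE.
apply/mem_intervals/eqP => [[/size0nil -> _ _ /size_tle /size0nil ->] //|[-> ->]].
by split=> //; [exact: dyck_nil|exact: dyck_nil|exact: tle_refl].
Qed.

Lemma Fcoef0 : Fcoef x 0 = 1.
Proof. by rewrite /Fcoef (perm_big _ perm_intervals0) big_seq1. Qed.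

Lemma Hcoef0 : Hcoef x 0 = 1.
Proof. by rewrite /Hcoef (perm_big _ perm_intervals0) big_seq1 /= addr0 mulr1. Qed.

End GeneratingFunctions.

Lemma H1_Hcoef n : H1 n = Hcoef 'X 1 n.
Proof.
rewrite /H1 /Hcoef /intervals big_map big_enum /= pair_big_dep /=.
apply: eq_big => [R|R /andP[_ /andP[/is_dyckP dQ _]]] //.
by rewrite expr1n mul1r -(sum_height _ dQ) size_tuple.
Qed.

Section Morphism.
Variables (S S' : comNzRingType) (phi : {rmorphism S -> S'}).

Lemma rmorph_height_sum s h p : phi (height_sum s h p) = height_sum (phi s) h p.
Proof.
elim: p h => [|[] p IH] h /=; rewrite rmorphD rmorphXn ?IH //.
by rewrite rmorph0.
Qed.

Lemma rmorph_Fcoef y n : phi (Fcoef y n) = Fcoef (phi y) n.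
Proof. by rewrite rmorph_sum; apply: eq_bigr => R _; rewrite rmorphXn. Qed.

Lemma rmorph_Hcoef s y n : phi (Hcoef s y n) = Hcoef (phi s) (phi y) n.
Proof.
rewrite rmorph_sum; apply: eq_bigr => R _.
by rewrite rmorphM rmorphXn rmorph_height_sum.
Qed.
End Morphism.

(** * The kernel method *)

Section FunctionalEquations.
Variables (S : comNzRingType) (s x : S).
Local Notation t := (fps_X S : fps S).
Local Notation F := (Fcoef x : fps S).
Local Notation H := (Hcoef s x : fps S).
Local Notation F1 := (Fcoef 1 : fps S).
Local Notation H1 := (Hcoef s 1 : fps S).
Local Notation M := (Mcoef x : fps S).
Local Notation N := (Ncoef s x : fps S).
Local Notation C := (@fps_const S).

Lemma fps_McoefE : (C x - 1) * M = C x * F - F1.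
Proof.
apply: fps_ext => n; rewrite -(rmorph1 C) -rmorphB fps_coefB !fps_coefCM.
exact: McoefE.
Qed.

Lemma fps_NcoefE : (C x - 1) * N = C x * H - H1.
Proof.
apply: fps_ext => n; rewrite -(rmorph1 C) -rmorphB fps_coefB !fps_coefCM.
exact: NcoefE.
Qed.

Lemma fps_FcoefE : F = 1 + t * (C x * (M * F)).
Proof.
apply: fps_ext => -[|n]; rewrite fps_coefD fps_coef1 ?fps_coefXM0 ?fps_coefXM.
  by rewrite Fcoef0 addr0.
by rewrite add0r fps_coefCM FcoefS.
Qed.

Lemma fps_HcoefE : H = 1 + t * (C x * (M * F + C s * (N * F) + M * H)).
Proof.
apply: fps_ext => -[|n]; rewrite fps_coefD fps_coef1 ?fps_coefXM0 ?fps_coefXM.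
  by rewrite Hcoef0 addr0.
rewrite add0r fps_coefCM HcoefS !big_split -mulr_sumr; congr (_ * _).
by rewrite !fps_coefD fps_coefCM.
Qed.

Lemma fps_Fcoef_eq : (C x - 1) * (F - 1) = C x * t * (F * (C x * F - F1)).
Proof. by rewrite [in LHS]fps_FcoefE -fps_McoefE; ring. Qed.

Lemma fps_Hcoef_eq :
  (C x - 1) * (H - F ^+ 2) = t * C s * C x * F ^+ 2 * (C x * H - H1).
Proof.
have EF := fps_FcoefE; have EH := fps_HcoefE; rewrite -fps_NcoefE.
move: EF EH; move: F H M N (C x) (C s) => f h m n y c Ef Eh.
(* In this combination the terms in [m] cancel and only the one in [n] survives. *)
have -> : (y - 1) * (h - f ^+ 2) = (y - 1) * (f * (h - 1) - (f + h) * (f - 1)) by ring.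
have -> : h - 1 = t * (y * (m * f + c * (n * f) + m * h)) by rewrite {1}Eh addrC addKr.
have -> : f - 1 = t * (y * (m * f)) by rewrite {1}Ef addrC addKr.
ring.
Qed.
End FunctionalEquations.

(** * Specialisation of the contact variable to a power series *)

Section SubstRmorphism.
Variables (R : comNzRingType) (T : fps R) (T0 : T 0%N = 0).
Definition fps_subst_rmorphism : {rmorphism fps (fps R) -> fps R} :=
  HB.pack (fps_subst T)
    (GRing.isZmodMorphism.Build _ _ _ (fps_subst_zmod T))
    (GRing.isMonoidMorphism.Build _ _ _ (fps_subst_monoid T0)).
End SubstRmorphism.

Section SubstX.
Variable R : comNzRingType.
Local Notation t := (fps_X R : fps R).

Lemma fps_coefXn k n : (t ^+ k) n = (n == k)%:R.
Proof.
elim: k n => [|k IH] [|n]; rewrite ?expr0 ?fps_coef1 // exprS.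
  by rewrite fps_coefXM0.
by rewrite fps_coefXM IH.
Qed.

Lemma fps_subst_map_const (U : fps R) : fps_subst t (fps_map (@fps_const R) U) = U.
Proof.
apply: fps_ext => n; rewrite /fps_subst (bigD1 ord_max) //= big1 ?addr0.
  by rewrite fps_coefCM fps_coefXn eqxx mulr1.
move=> i /eqP ne; rewrite fps_coefCM fps_coefXn; case: eqP => [E|_]; last exact: mulr0.
by case: ne; apply: val_inj.
Qed.
End SubstX.

Section Values.
Variables (R : comNzRingType) (sigma : R).
Local Notation t := (fps_X R : fps R).
(** The variable [x] is first taken in the ring of series in [t], which gives a series in a second
    variable [t']; then [t'] is identified with [t]. *)
Definition Fval (X : fps R) : fps R := fps_subst t (Fcoef X).
Definition Hval (X : fps R) : fps R := fps_subst t (Hcoef (fps_const sigma) X).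

Lemma Fval_eq X :
  (X - 1) * (Fval X - 1) = X * t * (Fval X * (X * Fval X - Fval 1)).
Proof.
have t0 : t 0%N = 0 by [].
have := congr1 (fps_subst_rmorphism t0) (fps_Fcoef_eq X).
by rewrite !(rmorphM, rmorphB, rmorph1) /= fps_subst_const fps_substX.
Qed.

Lemma Hval_eq X : (X - 1) * (Hval X - Fval X ^+ 2) =
  t * fps_const sigma * X * Fval X ^+ 2 * (X * Hval X - Hval 1).
Proof.
have t0 : t 0%N = 0 by [].
have := congr1 (fps_subst_rmorphism t0) (fps_Hcoef_eq (fps_const sigma) X).
by rewrite !(rmorphM, rmorphB, rmorph1, rmorphXn) /= !fps_subst_const fps_substX.
Qed.

(** At [x = 1] the coefficients are constant series in [t], so identifying the two variables merely
    renames one. *)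
Lemma Hval1 : Hval 1 = Hcoef sigma 1.
Proof.
rewrite -[RHS]fps_subst_map_const; congr fps_subst; apply: fps_ext => n.
by rewrite /fps_map rmorph_Hcoef rmorph1.
Qed.

Lemma Fval_coef0 X : Fval X 0%N = 1.
Proof. by rewrite /Fval /fps_subst big_ord1 Fcoef0 mulr1. Qed.

End Values.

Lemma fps_mapX (R R' : comNzRingType) (phi : {rmorphism R -> R'}) :
  fps_map phi (fps_X R) = fps_X R'.
Proof. by apply: fps_ext => n; rewrite /fps_map /fps_X rmorph_nat. Qed.

Lemma fps_map_Fval (R R' : comNzRingType) (phi : {rmorphism R -> R'}) (X : fps R) :
  fps_map phi (Fval X) = Fval (fps_map phi X).
Proof.
apply: fps_ext => n; rewrite {1}/fps_map /Fval /fps_subst rmorph_sum.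
apply: eq_bigr => k _; rewrite -/(fps_map phi _ n) rmorphM rmorphXn /= fps_mapX.
by rewrite rmorph_Fcoef.
Qed.

(** * Algebra of the quadratic equation and of the kernel *)

Section QuadraticEquation.
Variables (R : comNzRingType) (t x : R).

(** Keeping [f] and [f'] apart serves [fps_kernel_uniq]: both differences on the right carry the
    factor [t], which allows an induction on the degree. *)
Lemma quadratic_sub f f' a b :
  (x - 1) * (a - 1) = x * t * (a * (x * a - f)) ->
  (x - 1) * (b - 1) = x * t * (b * (x * b - f')) ->
  (x - 1) * (a - b) = t * ((a - b) * (x * (x * (a + b) - f)) + (f - f') * - (x * b)).
Proof.
move=> Ea Eb; have -> : (x - 1) * (a - b) = (x - 1) * (a - 1) - (x - 1) * (b - 1) by ring.
rewrite Ea Eb; ring.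
Qed.

Lemma quadratic_sub_root f a b :
  (x - 1) * (a - 1) = x * t * (a * (x * a - f)) ->
  (x - 1) * (b - 1) = x * t * (b * (x * b - f)) ->
  (x - 1 - t * (x ^+ 2 * (a + b)) + t * (x * f)) * (a - b) = 0.
Proof.
move=> Ea Eb; rewrite mulrDl mulrBl (quadratic_sub Ea Eb); ring.
Qed.

(** At a root of the kernel the terms in [h] on the two sides coincide, which leaves a relation for
    [h1] alone. *)
Lemma kernel_root s a h h1 : x - 1 = t * s * (x * a) ^+ 2 ->
  (x - 1) * (h - a ^+ 2) = t * s * x * a ^+ 2 * (x * h - h1) ->
  t * s * x * a ^+ 2 * h1 = t * s * x * a ^+ 2 * (x * a ^+ 2).
Proof.
move=> -> E; apply/eqP; rewrite -subr_eq0; apply/eqP.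
transitivity (t * s * (x * a) ^+ 2 * (h - a ^+ 2) - t * s * x * a ^+ 2 * (x * h - h1)).
  ring.
by rewrite E subrr.
Qed.

End QuadraticEquation.

(* [X], [Phi] and [f] are the values of [x], [F(x)] and [F(1)] in the rational
   parametrization of Bousquet-Melou, Fusy and Preville-Ratelle. *)
Section Parametrization.
Variables (R : comNzRingType) (t z v w y : R).
Hypotheses (Et : t = z * (1 - z) ^+ 3) (Ew : (1 - z) * w = 1) (Ey : (1 + z * v) * y = 1).
Let N := 1 - z *+ 2 - v * z ^+ 2.
Let X := (1 + v) * y ^+ 2.
Let Phi := (1 + z * v) * N * w ^+ 3.
Let f := (1 - z *+ 2) * w ^+ 3.

Lemma param_X_sub1 : X - 1 = v * N * y ^+ 2.
Proof.
have -> : X - 1 = X - ((1 + z * v) * y) ^+ 2 by rewrite Ey expr1n.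
rewrite /X /N; ring.
Qed.

Lemma param_tw : t * w ^+ 3 = z.
Proof. by rewrite Et -mulrA -exprMn Ew expr1n mulr1. Qed.

Lemma param_XPhi : X * Phi = (1 + v) * N * y * w ^+ 3.
Proof.
have -> : X * Phi = (1 + v) * N * y * w ^+ 3 * ((1 + z * v) * y) by rewrite /X /Phi; ring.
by rewrite Ey mulr1.
Qed.

Lemma param_F_eq : (X - 1) * (Phi - 1) = X * t * (Phi * (X * Phi - f)).
Proof.
have -> : X * t * (Phi * (X * Phi - f)) = t * (X * Phi) * (X * Phi - f) by ring.
rewrite param_X_sub1 param_XPhi.
have -> : t * ((1 + v) * N * y * w ^+ 3) = (1 + v) * N * y * z by rewrite -param_tw; ring.
have -> : Phi - 1 = w ^+ 3 * ((1 + z * v) * N - (1 - z) ^+ 3).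
  by rewrite mulrBr -exprMn [w * _]mulrC Ew expr1n /Phi; ring.
have -> : f = w ^+ 3 * (1 - z *+ 2) * ((1 + z * v) * y) by rewrite Ey /f; ring.
rewrite /N; ring.
Qed.

(** The hypothesis is the equation [P(v,z,sigma) = 0], rearranged. *)
Lemma param_kernel sigma :
  v * (1 - z) ^+ 3 = sigma * (z * ((1 + v) ^+ 2 * N)) ->
  X - 1 = t * sigma * (X * Phi) ^+ 2.
Proof.
move=> Ev; rewrite param_X_sub1 param_XPhi.
have -> : v * N * y ^+ 2 = v * (1 - z) ^+ 3 * (w ^+ 3 * N * y ^+ 2).
  by transitivity (v * N * y ^+ 2 * ((1 - z) * w) ^+ 3); [rewrite Ew expr1n mulr1 | ring].
by rewrite Ev -[in LHS]param_tw; ring.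
Qed.

Lemma param_XPhi2 : X * Phi ^+ 2 * (1 - z) ^+ 6 = (1 + v) * N ^+ 2.
Proof.
have -> : X * Phi ^+ 2 * (1 - z) ^+ 6 =
   (1 + v) * N ^+ 2 * ((1 + z * v) * y) ^+ 2 * ((1 - z) * w) ^+ 6 by rewrite /X /Phi; ring.
by rewrite Ey Ew !expr1n !mulr1.
Qed.
End Parametrization.

(** * Explicit values of F(1) and H(1) over Q[s] *)

Section Solution.
Local Notation A := {poly rat}.
Local Notation t := (fps_X A : fps A).
Local Notation sigma := (fps_const 'X : fps A).

(** Constants are embedded back, so that setting [s = 0] is an endomorphism and a series can be
    compared with its own specialisation. *)
Definition at_s0 : {rmorphism A -> A} := @polyC rat \o horner_eval (0 : rat).

Lemma fps_at_s0_sigma : fps_map at_s0 sigma = 0.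
Proof.
by apply: fps_ext => -[|n]; rewrite /fps_map /at_s0 /= /horner_eval ?hornerX ?horner0.
Qed.

(* [f = F(1)] is unknown but equals [d] at [s = 0], so both are determined
   together, coefficient by coefficient. *)
Lemma fps_kernel_uniq (K d a b : fps A) : K 0%N = 1 ->
  sigma * K * d = t * (d * a + fps_map at_s0 d * b) -> d = 0.
Proof.
move=> K0 E; apply: fps_ext => n; rewrite fps_coef0.
elim/ltn_ind: n => n IH.
have := congr1 (fun f : fps A => f n) E; rewrite -mulrA fps_coefCM.
have -> : (K * d) n = d n.
  rewrite fps_coefM big_ord_recl K0 mul1r subn0 big1 ?addr0 // => i _.
  by rewrite IH ?mulr0 //= /bump /=; have := ltn_ord i; lia.
have -> : (t * (d * a + fps_map at_s0 d * b)) n = 0.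
  case: n IH {E} => [|n] IH; rewrite ?fps_coefXM0 // fps_coefXM fps_coefD.
  rewrite !(@fps_coefM_lt _ _ _ n.+1) ?addr0 // => m mn.
    by rewrite /fps_map IH ?rmorph0.
by move/eqP; rewrite mulf_eq0 polyX_eq0 => /eqP.
Qed.

Variables z w : fps A.
Hypotheses (z0 : z 0%N = 0) (Et : t = z * (1 - z) ^+ 3) (Ew : (1 - z) * w = 1).
Hypothesis z_cst : fps_map at_s0 z = z.

Lemma w_coef0 : w 0%N = 1.
Proof.
have := congr1 (fun f : fps A => f 0%N) Ew.
by rewrite !fps_coefE z0 subr0 mul1r.
Qed.

Lemma w_cst : fps_map at_s0 w = w.
Proof.
have E : (1 - z) * fps_map at_s0 w = 1.
  by rewrite -[in LHS]z_cst -(rmorph1 (fps_map at_s0)) -rmorphB -rmorphM Ew.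
by rewrite -[LHS]mul1r -Ew mulrC mulrA [_ * (1 - z)]mulrC E mul1r.
Qed.

(** Here [v] is the indeterminate [s] itself. Then [X] becomes [1] at [s = 0], where the identity
    F(X) = [Phi] reads F(1) = [f]. *)
Lemma Fval1E : Fval 1 = (1 - z *+ 2) * w ^+ 3.
Proof.
have [|y Ey] := @fps_inv _ (1 + z * sigma).
  by rewrite !fps_coefE z0 mul0r addr0.
have y0 : y 0%N = 1.
  have := congr1 (fun f : fps A => f 0%N) Ey.
  by rewrite !fps_coefE z0 mul0r addr0 mul1r.
have psi_y : fps_map at_s0 y = 1.
  have := congr1 (fps_map at_s0) Ey.
  by rewrite rmorphM rmorphD rmorphM /= fps_at_s0_sigma mulr0 rmorph1 addr0 mul1r.
pose X := (1 + sigma) * y ^+ 2.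
pose N := 1 - z *+ 2 - sigma * z ^+ 2.
pose Phi := (1 + z * sigma) * N * w ^+ 3.
pose f := (1 - z *+ 2) * w ^+ 3.
have psi_X : fps_map at_s0 X = 1.
  by rewrite rmorphM rmorphXn rmorphD /= psi_y fps_at_s0_sigma rmorph1 addr0 expr1n mulr1.
have psi_Phi : fps_map at_s0 Phi = f.
  rewrite rmorphM rmorphXn rmorphM rmorphD rmorphM !rmorphB rmorphM rmorphMn rmorph1 /=.
  by rewrite fps_at_s0_sigma z_cst w_cst mulr0 mul0r addr0 subr0 mul1r.
have E1 : (X - 1) * (Phi - 1) = X * t * (Phi * (X * Phi - f)).
  exact: param_F_eq Et Ew Ey.
have E2 := Fval_eq X.
have EX : X - 1 = sigma * N * y ^+ 2 by exact: param_X_sub1 Ey.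
have psi_d : fps_map at_s0 (Fval X - Phi) = Fval 1 - f.
  by rewrite rmorphB /= fps_map_Fval psi_X psi_Phi.
have d0 : Fval X - Phi = 0.
  (* [X - 1] supplies the factor [sigma * K], with [K = N * y ^+ 2] of constant term [1]. *)
  apply: (@fps_kernel_uniq (N * y ^+ 2) _
    (X * (X * (Fval X + Phi) - Fval 1)) (- (X * Phi))).
    by rewrite /N !fps_coefE y0 z0 /=; ring.
  rewrite psi_d [sigma * _]mulrA -EX.
  exact: quadratic_sub E2 E1.
by apply/eqP; rewrite -subr_eq0 -/f -psi_d d0 rmorph0.
Qed.

Variable V : fps A.
Hypothesis z1 : z 1%N = 1.
Hypothesis EV : V * (1 - z) ^+ 3 =
  sigma * (z * ((1 + V) ^+ 2 * (1 - z *+ 2 - V * z ^+ 2))).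

Lemma V_coef0 : V 0%N = 0.
Proof.
have := congr1 (fun f : fps A => f 0%N) EV.
by rewrite !fps_coefE z0 mul0r mulr0 subr0 expr1n mulr1.
Qed.

(** This first-order term is what tells the two roots of the quadratic equation apart in
    [Hval1E]. *)
Lemma V_coef1 : V 1%N = 'X.
Proof.
have := congr1 (fun f : fps A => f 1%N) EV.
rewrite !(fps_coefE, fps_coefCM) z0 z1 V_coef0 /= => E.
have -> : V 1%N = V 1%N * (1 - 0) ^+ 3 by ring.
by move: E; rewrite mul0r add0r => ->; ring.
Qed.

Lemma Hval1E : Hval 'X 1 * (1 - z) ^+ 6 = (1 + V) * (1 - z *+ 2 - V * z ^+ 2) ^+ 2.
Proof.
have [|y Ey] := @fps_inv _ (1 + z * V).
  by rewrite !fps_coefE z0 mul0r addr0.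
have y0 : y 0%N = 1.
  have := congr1 (fun f : fps A => f 0%N) Ey.
  by rewrite !fps_coefE z0 mul0r addr0 mul1r.
have y1 : y 1%N = 0.
  have := congr1 (fun f : fps A => f 1%N) Ey.
  by rewrite !fps_coefE z0 V_coef0 y0 !(mul0r, mulr0, addr0, mul1r, mulr1).
rewrite -(param_XPhi2 Ew Ey).
set N := 1 - z *+ 2 - V * z ^+ 2.
set X := (1 + V) * y ^+ 2.
set Phi := (1 + z * V) * N * w ^+ 3.
have E1 : (X - 1) * (Phi - 1) = X * t * (Phi * (X * Phi - Fval 1)).
  by rewrite Fval1E; exact: param_F_eq Et Ew Ey.
have EK : X - 1 = t * sigma * (X * Phi) ^+ 2 by exact: param_kernel Et Ew Ey _ EV.
have X0 : X 0%N = 1.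
  by rewrite /X !fps_coefE V_coef0 y0 /=; ring.
have X1 : X 1%N = 'X.
  by rewrite /X expr2 !fps_coefE y0 y1 V_coef0 V_coef1 /=; ring.
have Phi0 : Phi 0%N = 1.
  by rewrite /Phi /N !fps_coefE w_coef0 V_coef0 z0 /=; ring.
have neq0 (f : fps A) : f 0%N = 1 -> f <> 0.
  by move=> f0 E; move/eqP: f0; rewrite E fps_coef0 eq_sym oner_eq0.
have FE : Fval X = Phi.
  apply/eqP; rewrite -subr_eq0; apply/eqP.
  (* [F(X)] and [Phi] are roots of one quadratic equation; [K] is the other
     factor of the difference, and [K = (s - 1) t + O(t^2)] is not zero. *)
  pose K := X - 1 - t * (X ^+ 2 * (Fval X + Phi)) + t * (X * Fval 1).
  have EKd : K * (Fval X - Phi) = 0 by exact: quadratic_sub_root (Fval_eq X) E1.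
  case: (fps_mul_eq0 EKd) => // /(congr1 (fun f : fps A => f 1%N)).
  rewrite /K !fps_coefE !Fval_coef0 X0 X1 Phi0 fps_coef0 /fps_X /=.
  rewrite !(expr1n, mul0r, mul1r, mulr1, add0r, addr0, subr0) opprD addrA subrK.
  move/eqP; rewrite subr_eq0 => /eqP /(congr1 (fun p : {poly rat} => size p)).
  by rewrite size_polyX size_poly1.
have E3 := Hval_eq 'X X; rewrite FE in E3.
(* The kernel yields H(1) = [X * Phi ^+ 2] up to the factor [t * sigma * X * Phi ^+ 2], a product of
   nonzero series over an integral domain. *)
congr (_ * _); have := kernel_root EK E3.
apply: fps_mulI.
have mul_neq0 (f g : fps A) : f <> 0 -> g <> 0 -> f * g <> 0.
  by move=> f0 g0 /fps_mul_eq0 [].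
have t_neq0 : t <> 0.
  by move/(congr1 (fun f : fps A => f 1%N)) => /eqP; rewrite fps_coef0 /fps_X /= oner_eq0.
have sigma_neq0 : sigma <> 0.
  by move/(congr1 (fun f : fps A => f 0%N)) => /eqP; rewrite fps_coef0 /= polyX_eq0.
apply: (mul_neq0); last by apply: neq0; rewrite fps_coefX0 Phi0 expr1n.
apply: (mul_neq0); [exact: mul_neq0 | exact: neq0].
Qed.
End Solution.

Theorem theorem2p3 (z : fps rat) (U : fps {poly rat}) :
  (* z = z(t): t = z (1-z)^3, z = t + O(t^2) *)
  z 0%N = 0 -> z 1%N = 1 ->
  fps_X rat =1 fps_mul z (fps_pow (fps_sub (fps_one rat) z) 3) ->
  (* U = U(z,s) in Q[s][[z]] with P(U,z,s) = 0 *)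
  Pol_series U =1 fps_const 0 ->
  let Z := fps_map (fun a : rat => a%:P) z in     (* z(t) over Q[s] *)
  let V := fps_comp U Z in                         (* U(z(t),s) *)
  let one := fps_one {poly rat} in
  (* H(1) = (1 - 2z - U z^2)^2 (1+U) / (1-z)^6, written multiplied out *)
  fps_mul H1 (fps_pow (fps_sub one Z) 6)
    =1 fps_mul (fps_pow (fps_sub (fps_sub one (fps_scale 2 Z))
                                 (fps_mul V (fps_pow Z 2))) 2)
               (fps_add one V)
  /\
  (* equivalently s = U (1-z)^3 / (z (1+U)^2 (1 - U z^2 - 2z)), multiplied out *)
  fps_mul (fps_const 'X)
     (fps_mul (fps_X {poly rat})
        (fps_mul (fps_pow (fps_add one U) 2)
           (fps_sub (fps_sub one (fps_mul U (fps_pow (fps_X {poly rat}) 2)))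
                    (fps_scale 2 (fps_X {poly rat})))))
    =1 fps_mul U (fps_pow (fps_sub one (fps_X {poly rat})) 3).
Proof.
move=> z0 z1 /fps_ext Ez /fps_ext EU Z V one.
(* [t] plays two roles: it stands for the variable z in the equation of [U], and for t once [Z] has
   been substituted. *)
pose t := fps_X {poly rat} : fps {poly rat}.
pose sigma := fps_const 'X : fps {poly rat}.
have {}EU : sigma * (t * ((1 + U) ^+ 2 * (1 - U * t ^+ 2 - t *+ 2))) = U * (1 - t) ^+ 3.
  have {}EU : sigma * ((1 + U) ^+ 2 * (t * (U * t ^+ 2 + t *+ 2 - 1))) +
      U * (1 - t) ^+ 3 = 0.
    by rewrite -!fps_powE -fps_scaleE; apply: etrans EU _; apply: rmorph0.
  move: sigma t (U : fps {poly rat}) EU {V} => c x u E.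
  by apply/eqP; rewrite eq_sym -subr_eq0 -E; apply/eqP; ring.
split; last first.
  by move=> n; rewrite !fps_powE fps_scaleE; apply: (congr1 (fun f : fps _ => f n) EU).
have Z0 : Z 0%N = 0 by rewrite /Z /fps_map z0.
have Z1 : Z 1%N = 1 by rewrite /Z /fps_map z1.
have EZ : t = Z * (1 - Z) ^+ 3.
  transitivity (fps_map (@polyC rat) (z * (1 - z) ^+ 3)).
    rewrite -fps_powE; apply: etrans (congr1 (fps_map (@polyC rat)) Ez).
    by rewrite fps_mapX.
  by rewrite [LHS]rmorphM rmorphXn rmorphB rmorph1.
have [|w Ew] := @fps_inv _ (1 - Z); first by rewrite !fps_coefE Z0 subr0.
have Z_cst : fps_map at_s0 Z = Z.
  by apply: fps_ext => n; rewrite /fps_map /= /horner_eval hornerC.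
have EV : V * (1 - Z) ^+ 3 =
    sigma * (Z * ((1 + V) ^+ 2 * (1 - Z *+ 2 - V * Z ^+ 2))).
  (* [phi] substitutes z = z(t) and fixes [s], so it carries the equation of [U] to that of [V]. *)
  pose phi : {rmorphism fps {poly rat} -> fps {poly rat}} :=
    fps_subst_rmorphism Z0 \o fps_map (@fps_const {poly rat}).
  have phi_t : phi t = Z by rewrite /= fps_mapX fps_substX.
  have phi_sigma : phi sigma = sigma.
    rewrite /= -[RHS](fps_subst_const Z); congr fps_subst.
    by apply: fps_ext => -[|n]; rewrite /fps_map //= rmorph0.
  have phi_U : phi U = V by rewrite /= /V fps_compE.
  have phi_N : phi (1 - U * t ^+ 2 - t *+ 2) = 1 - Z *+ 2 - V * Z ^+ 2.
    rewrite rmorphB rmorphB rmorphM rmorphXn rmorphMn rmorph1 phi_t phi_U.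
    exact: addrAC.
  have phi_l : phi (U * (1 - t) ^+ 3) = V * (1 - Z) ^+ 3.
    by rewrite rmorphM rmorphXn rmorphB rmorph1 phi_t phi_U.
  rewrite -phi_l -EU 3!rmorphM rmorphXn rmorphD rmorph1.
  by rewrite phi_N phi_t phi_sigma phi_U.
move=> n; rewrite !fps_powE fps_scaleE.
have := Hval1E Z0 EZ Ew Z_cst Z1 EV; rewrite Hval1 => E.
have -> : H1 = Hcoef 'X 1 by apply: fps_ext => m; apply: H1_Hcoef.
by rewrite [RHS]mulrC in E; apply: (congr1 (fun f : fps _ => f n) E).
Qed.
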